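(* Let $m_2<m_1$ be nonnegative integers with $m_1+m_2$ even. If $p=\dfrac{m_1+m_2+1}{2}$, then $M_{p,m_1,m_2}(a,b)=\sqrt{ab}$ for all $a,b>0$.
   Context: Let $m_2<m_1$ be nonnegative integers and $n=m_1+m_2+1$. For $f\in C^{n+2}(0,\infty)$ with $f^{(n+1)}$ nowhere zero and $0<a<b$, let $P,Q$ be the unique polynomials of degree at most $n$ with $P^{(j)}(a)=f^{(j)}(a)$ for $0\le j\le m_1$, $P^{(j)}(b)=f^{(j)}(b)$ for $0\le j\le m_2$, and $Q^{(j)}(a)=f^{(j)}(a)$ for $0\le j\le m_2$, $Q^{(j)}(b)=f^{(j)}(b)$ for $0\le j\le m_1$. The equation $f(x)-P(x)=(-1)^{m_1-m_2}\,(f(x)-Q(x))$ has exactly one solution $x\in(a,b)$, and this solution is denoted $M_{f,m_1,m_2}(a,b)$. One extends the definition by $M_{f,m_1,m_2}(b,a)=M_{f,m_1,m_2}(a,b)$ and $M_{f,m_1,m_2}(a,a)=a$. For real $p\notin\{0,1,\dots,n\}$, $M_{p,m_1,m_2}$ denotes $M_{f,m_1,m_2}$ with $f(x)=x^p$. *)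

(* Defs.v *)
From mathcomp Require Import all_boot all_order all_algebra.
From mathcomp Require Import all_classical all_reals all_analysis.

Set Implicit Arguments.
Unset Strict Implicit.
Unset Printing Implicit Defensive.

Import Order.TTheory GRing.Theory Num.Theory.
Import numFieldNormedType.Exports.

Local Open Scope classical_set_scope.
Local Open Scope ring_scope.

(* [size P <= (k + l).+2] says that the degree is at most n = k + l + 1. *)
Definition is_hermite (R : realType) (f : R -> R) (a : R) (k : nat) (b : R)
    (l : nat) (P : {poly R}) : Prop :=
  [/\ (size P <= (k + l).+2)%N,
      forall j, (j <= k)%N -> (derivn j P).[a] = derive1n j f a &
      forall j, (j <= l)%N -> (derivn j P).[b] = derive1n j f b].

(* For a <> b there is exactly one such polynomial; the default 0 is
   irrelevant. *)
Definition hermite (R : realType) (f : R -> R) (a : R) (k : nat) (b : R)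
    (l : nat) : {poly R} :=
  xget 0 [set P | is_hermite f a k b l P].

(* The exponent m1 - m2 is a truncated subtraction, used only for m2 < m1. *)
Definition hermite_mean_eq (R : realType) (f : R -> R) (m1 m2 : nat)
    (a b x : R) : Prop :=
  let P := hermite f a m1 b m2 in
  let Q := hermite f a m2 b m1 in
  f x - P.[x] = (-1) ^+ (m1 - m2) * (f x - Q.[x]).

(* For 0 < a < b, m2 < m1 and f of class C^(m1 + m2 + 3) on the positive
   half-line with nowhere vanishing derivative of order m1 + m2 + 2, the
   equation has exactly one solution strictly between a and b, so the default
   value of xget (an endpoint, hence not a solution) is never taken. *)
Definition hermite_mean_lt (R : realType) (f : R -> R) (m1 m2 : nat)
    (a b : R) : R :=
  xget a [set x | a < x < b /\ hermite_mean_eq f m1 m2 a b x].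

Definition hermite_mean (R : realType) (f : R -> R) (m1 m2 : nat)
    (a b : R) : R :=
  if a < b then hermite_mean_lt f m1 m2 a b
  else if b < a then hermite_mean_lt f m1 m2 b a
  else a.

Definition power_hermite_mean (R : realType) (p : R) (m1 m2 : nat)
    (a b : R) : R :=
  hermite_mean (fun x : R => x `^ p) m1 m2 a b.

(* Main.v *)
Require Import Defs.
From mathcomp Require Import all_boot all_order all_algebra.
From mathcomp Require Import all_classical all_reals all_analysis.
From mathcomp Require Import ring zify.
Set Implicit Arguments.
Unset Strict Implicit.
Unset Printing Implicit Defensive.
Import Order.TTheory GRing.Theory Num.Theory.
Import numFieldNormedType.Exports.
Local Open Scope ring_scope.

(* Put s = sqrt (a b), n = m1 + m2 + 1 and f x = x^(n/2). As m1 - m2 is even the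
   equation is P x = Q x. Since s^n f x = x^n f (a b / x), the polynomial
   s^-n x^n P (a b / x) interpolates f with the roles of a and b exchanged, so
   it is Q, and x = s gives P s = Q s.
   For uniqueness, the same symmetry maps a solution x < s to y = a b / x > s
   and gives f y - Q y = (s / x)^n (f x - Q x). Let W be the monic polynomial of
   degree n + 1 with zeros of order m2 + 1 at a and m1 + 1 at b. The quotient
   |f - Q| / |W| is strictly decreasing, because the derivatives of f of orders
   n + 1 and n + 2 have opposite signs (Rolle with multiplicities). On the other
   hand |W y| <= (s / x)^n |W x|, so the quotient at y is at least that at x. *)

(** * Sequences of successive derivatives on the positive half-line *)

Definition der_family {R : realType} (E : nat -> R -> R) : Prop :=
  forall i (x : R), 0 < x -> is_derive x 1 (E i) (E i.+1 x).

Lemma der_family_shift {R : realType} (E : nat -> R -> R) :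
  der_family E -> der_family (fun i => E i.+1).
Proof. by move=> dE i x; exact: dE. Qed.

Lemma der_family_horner {R : realType} (P : {poly R}) :
  der_family (fun i => horner (derivn i P)).
Proof. by move=> i x _; rewrite derivnS; exact: is_derive_poly. Qed.

Lemma der_familyB {R : realType} (E F : nat -> R -> R) :
  der_family E -> der_family F -> der_family (fun i x => E i x - F i x).
Proof. by move=> dE dF i x x0; apply: is_deriveB; [exact: dE|exact: dF]. Qed.

Lemma der_familyZ {R : realType} (k : R) (E : nat -> R -> R) :
  der_family E -> der_family (fun i x => k * E i x).
Proof. by move=> dE i x x0; apply: is_deriveZ; exact: dE. Qed.

Definition powR_family {R : realType} (p : R) (j : nat) (x : R) : R :=
  (\prod_(i < j) (p - i%:R)) * x `^ (p - j%:R).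

Lemma der_family_powR {R : realType} (p : R) : der_family (powR_family p).
Proof.
move=> i x x0; apply: is_derive_eq.
  by apply: is_deriveZ; exact: is_derive1_powR.
rewrite /powR_family big_ord_recr /= -mulrA; congr (_ * (_ * _ `^ _)).
by rewrite -natr1 opprD addrA.
Qed.

Lemma powR_family0 {R : realType} (p x : R) : powR_family p 0 x = x `^ p.
Proof. by rewrite /powR_family big_ord0 mul1r subr0. Qed.

Lemma near_gt0 {R : realType} (P : R -> Prop) (x : R) : 0 < x ->
  (forall y, 0 < y -> P y) -> \forall y \near x, P y.
Proof.
by move=> x0 H; near=> y; apply: H; near: y; exact: lt_nbhsr.
Unshelve. all: by end_near. Qed.

(** Carries the conditions of [is_hermite] over to families. Equality on the half-line suffices
    because that set is open, so it holds near each positive point. *)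
Lemma derive1n_family {R : realType} (f : R -> R) (E : nat -> R -> R) :
  der_family E -> (forall x, 0 < x -> f x = E 0%N x) ->
  forall j x, 0 < x -> derive1n j f x = E j x.
Proof.
move=> dE fE; elim=> [|j IH] x x0; first by rewrite derive1n0 fE.
rewrite derive1nS derive1E.
apply: derive_val; apply: (@near_eq_is_derive _ _ _ (E j)); last exact: dE.
by apply: near_gt0 => // y y0; rewrite IH.
Qed.

(** * Rolle's theorem counted with multiplicities *)

Lemma rolle_path {R : realType} (F F' : R -> R) (x0 : R) (s : seq R) :
  (forall x : R, 0 < x -> is_derive x 1 F (F' x)) ->
  0 < x0 -> path <%R x0 s -> {in x0 :: s, forall z, F z = 0} ->
  exists t, [/\ size t = size s, sorted <%R t &
    {in t, forall z, x0 < z < last x0 s /\ F' z = 0}].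
Proof.
move=> dF; elim: s x0 => [|x1 s IH] x0 x0gt0 /=; first by exists [::].
move=> /andP[x01 ps] z0.
have [|t [st sot tz]] := IH x1 (lt_trans x0gt0 x01) ps.
  by move=> z zs; apply: z0; rewrite inE zs orbT.
have [|||c] := @Rolle R F x0 x1 x01.
- move=> x; rewrite in_itv/= => /andP[x0x _].
  by apply: ex_derive; apply: dF; exact: lt_trans x0x.
- apply: derivable_within_continuous => x; rewrite in_itv/= => /andP[x0x _].
  by apply: ex_derive; apply: dF; exact: lt_le_trans x0x.
- by rewrite !z0 ?inE ?eqxx ?orbT.
rewrite in_itv/= => /andP[x0c cx1] dc.
have x1l : x1 <= last x1 s.
  move: ps; rewrite lt_path_sortedE => /andP[/allP alls _].
  by have := mem_last x1 s; rewrite inE => /orP[/eqP ->|/alls/ltW].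
exists (c :: t); split => /=; first by rewrite st.
  rewrite lt_path_sortedE sot andbT; apply/allP => z /tz[/andP[x1z _] _] /=.
  exact: lt_trans x1z.
move=> z; rewrite inE => /orP[/eqP->|/tz[/andP[x1z zl] ->]].
  split; first by rewrite x0c (lt_le_trans cx1).
  have [_ e1] := dc; have [_ e2] := dF c (lt_trans x0gt0 x0c).
  by rewrite -e2 -e1.
by rewrite zl (lt_trans x01 x1z).
Qed.

(* Differentiation lowers the multiplicities at a and b by one each, while
   Rolle's theorem supplies a new interior zero in every gap. *)
Lemma rolle_multiplicity {R : realType} (a b : R) (N : nat)
    (E : nat -> R -> R) (k l : nat) (s : seq R) :
  0 < a -> a < b -> der_family E -> (k + l + size s = N.+1)%N ->
  sorted <%R s ->
  (forall j, (j < k)%N -> E j a = 0) -> (forall j, (j < l)%N -> E j b = 0) ->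
  {in s, forall z, a < z < b /\ E 0%N z = 0} ->
  exists2 c, a <= c <= b & E N c = 0.
Proof.
move=> a0 ab; elim: N E k l s => [|N IH] E k l s dE sz sos Ea Eb Es.
  case: k sz Ea => [|k] sz Ea; last by exists a; rewrite ?lexx ?ltW// Ea.
  case: l sz Eb => [|l] sz Eb; last by exists b; rewrite ?lexx ?ltW// Eb.
  case: s sz sos Es => [//|z s] sz sos Es.
  have [/andP[az zb] z0] := Es z (mem_head _ _).
  by exists z => //; rewrite !ltW.
(* The distinct zeros of [E 0] in increasing order; an endpoint is listed once if its multiplicity
   is positive. *)
pose u := nseq (0 < k)%N a ++ s ++ nseq (0 < l)%N b.
have su : sorted <%R u.
  have ss : sorted <%R (s ++ nseq (0 < l)%N b).
    case: (l) => [|l']; first by rewrite cats0.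
    rewrite /= cats1; case: (s) sos Es => [//|z s'] /= pz Es.
    rewrite rcons_path pz; have /Es[/andP[_ ->]] := mem_last z s'; by [].
  rewrite /u; case: (k) => [//|k'] /=.
  rewrite lt_path_sortedE ss andbT; apply/allP => z.
  rewrite mem_cat mem_nseq => /orP[/Es[/andP[]]//|/andP[_ /eqP->]//].
have u0 : {in u, forall z, E 0%N z = 0}.
  move=> z; rewrite !mem_cat !mem_nseq => /or3P[/andP[k0 /eqP->]|/Es[]//|].
    by apply: Ea; case: (k) k0.
  by move=> /andP[l0 /eqP->]; apply: Eb; case: (l) l0.
have uab : {in u, forall z, a <= z <= b}.
  move=> z; rewrite !mem_cat !mem_nseq.
  move=> /or3P[/andP[k0 /eqP->]|/Es[]/andP[? ?] _|].
  - by rewrite lexx ltW.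
  - by rewrite !ltW.
  - by move=> /andP[l0 /eqP->]; rewrite lexx ltW.
have szu : size u = ((0 < k) + size s + (0 < l))%N.
  by rewrite !size_cat !size_nseq addnA.
case: u su u0 uab szu => [|x0 u] /= su u0 uab szu.
  by exfalso; case: (k) (l) sz szu => [|?] [|?]; lia.
have /andP[ax0 _] := uab x0 (mem_head _ _).
have [t [st sot tz]] :=
  @rolle_path R _ _ x0 u (dE 0%N) (lt_le_trans a0 ax0) su u0.
(* An endpoint in [u] loses one multiplicity but bounds a gap; as there is one gap fewer than
   points, the total drops by exactly one. *)
apply: (IH (fun i => E i.+1) k.-1 l.-1 t) => //.
- exact: der_family_shift.
- by rewrite st; case: (k) (l) sz szu => [|?] [|?]; lia.
- by move=> j jk; apply: Ea; lia.
- by move=> j jl; apply: Eb; lia.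
move=> z /tz[/andP[x0z zl] ->]; split => //.
have /andP[_ lb] := uab _ (mem_last x0 u).
by rewrite (le_lt_trans ax0 x0z) (lt_le_trans zl lb).
Qed.

(** * Existence and uniqueness of the Hermite interpolant *)

(** The derivative is again a cofactor times a power, which lets the next two lemmas go by induction
    with the cofactor general. *)
Lemma deriv_mul_XsubCX {R : comNzRingType} (A : {poly R}) (a : R) k :
  (A * ('X - a%:P) ^+ k.+1)^`() =
  (A^`() * ('X - a%:P) + A *+ k.+1) * ('X - a%:P) ^+ k.
Proof.
rewrite derivM deriv_exp derivXsubC mul1r /= mulrDl exprS mulrA.
by rewrite mulrnAl mulrnAr.
Qed.

Lemma horner_derivn_mul_XsubCX_lt {R : comNzRingType} (A : {poly R}) (a : R)
    (k j : nat) :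
  (j < k)%N -> (derivn j (A * ('X - a%:P) ^+ k)).[a] = 0.
Proof.
elim: j k A => [|j IH] [|k] A // jk.
  by rewrite derivn0 exprS mulrCA hornerM hornerXsubC subrr mul0r.
by rewrite derivSn deriv_mul_XsubCX IH.
Qed.

Lemma horner_derivn_mul_XsubCX {R : comNzRingType} (A : {poly R}) (a : R)
    (k : nat) :
  (derivn k (A * ('X - a%:P) ^+ k)).[a] = A.[a] *+ k`!.
Proof.
elim: k A => [|k IH] A; first by rewrite derivn0 expr0 mulr1.
rewrite derivSn deriv_mul_XsubCX IH hornerD hornerM hornerMn hornerXsubC subrr.
by rewrite mulr0 add0r -mulrnA factS.
Qed.

Lemma horner_derivn_top {R : nzRingType} (P : {poly R}) (N : nat) (x : R) :
  (size P <= N.+1)%N -> (derivn N P).[x] = P`_N *+ N`!.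
Proof.
move=> sP; suff -> : derivn N P = (P`_N *+ N`!)%:P by rewrite hornerC.
apply/polyP => i; rewrite coef_derivn coefC.
case: i => [|i] /=; first by rewrite addn0 ffactnn.
by rewrite nth_default ?mul0rn// (leq_trans sP)// addnS ltnS leq_addr.
Qed.

Lemma size_mul_XsubCX {R : idomainType} (a b : R) (k l : nat) :
  size (('X - a%:P) ^+ k * ('X - b%:P) ^+ l) = (k + l).+1.
Proof.
rewrite size_mul ?expf_neq0 ?polyXsubC_eq0// !size_exp_XsubC.
by rewrite addnS addSn.
Qed.

(** Newton's step: adding a multiple of (X - a)^k (X - b)^l keeps the earlier conditions, and moves
    the derivative of order l at b by that multiple of (b - a)^k l!, which is nonzero. *)
Lemma hermite_step {R : numFieldType} (a b : R) (k l : nat) (v : R)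
    (P : {poly R}) :
  a != b -> (size P <= k + l)%N ->
  exists P' : {poly R}, [/\ (size P' <= (k + l).+1)%N,
    forall j, (j < k)%N -> (derivn j P').[a] = (derivn j P).[a],
    forall j, (j < l)%N -> (derivn j P').[b] = (derivn j P).[b] &
    (derivn l P').[b] = v].
Proof.
move=> ab sP; pose W := ('X - a%:P) ^+ k * ('X - b%:P) ^+ l.
pose w := (b - a) ^+ k *+ l`!.
have w0 : w != 0.
  by rewrite mulrn_eq0 negb_or -lt0n fact_gt0 expf_neq0// subr_eq0 eq_sym.
exists (P + ((v - (derivn l P).[b]) / w) *: W); split.
- rewrite (leq_trans (size_polyD _ _))// geq_max leqW//=.
  by rewrite (leq_trans (size_scale_leq _ _))// size_mul_XsubCX.
- move=> j jk; rewrite derivnD derivnZ hornerD hornerZ /W [_ ^+ k * _]mulrC.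
  by rewrite horner_derivn_mul_XsubCX_lt// mulr0 addr0.
- move=> j jl; rewrite derivnD derivnZ hornerD hornerZ /W.
  by rewrite horner_derivn_mul_XsubCX_lt// mulr0 addr0.
rewrite derivnD derivnZ hornerD hornerZ /W horner_derivn_mul_XsubCX.
rewrite horner_exp hornerXsubC -/w divfK//.
by rewrite addrC subrK.
Qed.

Lemma hermite_interpolation {R : numFieldType} (a b : R) (k l : nat)
    (u v : nat -> R) :
  a != b ->
  exists P : {poly R}, [/\ (size P <= k + l)%N,
    forall j, (j < k)%N -> (derivn j P).[a] = u j &
    forall j, (j < l)%N -> (derivn j P).[b] = v j].
Proof.
move=> ab; elim: l => [|l [P [sP Pa Pb]]].
  elim: k => [|k [P [sP Pa _]]]; first by exists 0; rewrite size_poly0.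
  have ba : b != a by rewrite eq_sym.
  have [|P' [sP' _ P'a P'k]] := @hermite_step _ b a 0 k (u k) P ba.
    by rewrite add0n -[k]addn0.
  exists P'; split => //; first by rewrite addn0.
  by move=> j; rewrite ltnS leq_eqVlt => /orP[/eqP->//|jk]; rewrite P'a ?Pa.
have [P' [sP' P'a P'b P'l]] := @hermite_step _ a b k l (v l) P ab sP.
exists P'; split; first by rewrite addnS.
  by move=> j jk; rewrite P'a ?Pa.
by move=> j; rewrite ltnS leq_eqVlt => /orP[/eqP->//|jl]; rewrite P'b ?Pb.
Qed.

(** If P had degree m, Rolle would give a zero of its derivative of order m, a nonzero constant. *)
Lemma hermite_zero {R : realType} (a b : R) (k l : nat) (P : {poly R}) :
  0 < a -> a < b -> (size P <= k + l)%N ->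
  (forall j, (j < k)%N -> (derivn j P).[a] = 0) ->
  (forall j, (j < l)%N -> (derivn j P).[b] = 0) -> P = 0.
Proof.
move=> a0 ab sP Pa Pb; apply/eqP; rewrite -size_poly_eq0 -leqn0 leqNgt.
apply/negP; case sPE: (size P) => [//|m] _.
(* Exactly m + 1 of the k + l available conditions are selected. *)
have [|||||c _] := @rolle_multiplicity R a b m (fun i => horner (derivn i P))
  (minn k m.+1) (m.+1 - minn k m.+1) [::] a0 ab (der_family_horner P).
- by rewrite /=; lia.
- by [].
- by move=> j jk; apply: Pa; lia.
- by move=> j jl; apply: Pb; lia.
- by [].
rewrite horner_derivn_top ?sPE// => /eqP.
rewrite mulrn_eq0 gtn_eqF ?fact_gt0//= => /eqP Pm.
have : lead_coef P != 0 by rewrite lead_coef_eq0 -size_poly_eq0 sPE.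
by rewrite lead_coefE sPE Pm eqxx.
Qed.

(** * Order of vanishing under products and inversion *)

(* The derivatives of F of order < k exist on the positive half-line and are 0
   at a. This recursive form passes to products and to x |-> F (c / x) without a
   formula for the higher derivatives. *)
Fixpoint vanish {R : realType} (k : nat) (F : R -> R) (a : R) : Prop :=
  if k is k'.+1 then
    F a = 0 /\ exists F', (forall x : R, 0 < x -> is_derive x 1 F (F' x)) /\
                          vanish k' F' a
  else True.

Lemma eq_vanish {R : realType} (k : nat) (F G : R -> R) (a : R) :
  0 < a -> (forall x, 0 < x -> F x = G x) -> vanish k F a -> vanish k G a.
Proof.
case: k => [//|k] a0 FG [Fa [F' [dF vF']]]; split; first by rewrite -FG.
exists F'; split => // x x0; apply: near_eq_is_derive (dF x x0).
exact: near_gt0.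
Qed.

(** Derivatives are unique, so the witnesses inside [vanish] agree with the family on the
    half-line. *)
Lemma vanish_family {R : realType} (k : nat) (E : nat -> R -> R) (a : R) :
  0 < a -> der_family E ->
  vanish k (E 0%N) a <-> (forall j, (j < k)%N -> E j a = 0).
Proof.
move=> a0; elim: k E => [//|k IH] E dE; have dE' := der_family_shift dE.
split=> [[Ea [F' [dF vF']]] [|j] // jk|Ea].
  apply: (iffLR (IH _ dE')) jk; apply: eq_vanish vF' => // x x0.
  have [_ <-] := dF x x0; have [_ e] := dE 0%N x x0; exact: e.
split; first exact: Ea.
exists (E 1%N); split; first exact: dE.
by apply/(IH _ dE') => j jk; exact: Ea.
Qed.

Lemma vanishW {R : realType} (k : nat) (F : R -> R) (a : R) :
  vanish k.+1 F a -> vanish k F a.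
Proof.
elim: k F => [//|k IH] F [Fa [F' [dF vF']]]; split=> //.
by exists F'; split=> //; exact: IH.
Qed.

Lemma vanishD {R : realType} (k : nat) (F G : R -> R) (a : R) :
  vanish k F a -> vanish k G a -> vanish k (fun x => F x + G x) a.
Proof.
elim: k F G => [//|k IH] F G [Fa [F' [dF vF']]] [Ga [G' [dG vG']]].
split; first by rewrite Fa Ga addr0.
exists (fun x => F' x + G' x); split; last exact: IH.
by move=> x x0; apply: is_deriveD; [exact: dF|exact: dG].
Qed.

(** The product rule leaves E F' and E' F. The induction hypothesis covers both, the second with the
    shifted family and one order of vanishing of F given up. *)
Lemma vanish_mul {R : realType} (k : nat) (E : nat -> R -> R) (F : R -> R)
    (a : R) :
  der_family E -> vanish k F a -> vanish k (fun x => E 0%N x * F x) a.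
Proof.
elim: k E F => [//|k IH] E F dE vF; have [Fa [F' [dF vF']]] := vF.
split; first by rewrite Fa mulr0.
exists (fun x => E 0%N x * F' x + E 1%N x * F x); split; last first.
  apply: vanishD; first exact: IH.
  by apply: (IH (fun i => E i.+1)); [exact: der_family_shift|exact: vanishW].
move=> x x0; apply: is_derive_eq.
  by apply: is_deriveM; [exact: dE|exact: dF].
by rewrite [X in _ + X = _]mulrC.
Qed.

Lemma vanish_inv {R : realType} (k : nat) (F : R -> R) (c a : R) :
  0 < c -> 0 < a -> vanish k F a -> vanish k (fun x => F (c / x)) (c / a).
Proof.
move=> c0 a0; elim: k F => [//|k IH] F [Fa [F' [dF vF']]].
split; first by rewrite invf_div mulrCA mulfV ?mulr1 ?gt_eqF.
(* The family of - c x^-2, the derivative of c / x that the chain rule brings in. *)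
pose E i (x : R) := - c * powR_family (-2) i x.
exists (fun x => E 0%N x * F' (c / x)); split; last first.
  by apply: vanish_mul; [exact/der_familyZ/der_family_powR|exact: IH].
move=> x x0; apply: is_derive_eq.
  apply: (@is_derive1_comp R F (fun y => c / y)).
    by apply: dF; exact: divr_gt0.
  by apply: is_deriveZ; apply: is_deriveV; rewrite gt_eqF.
rewrite /E powR_family0 mulrC; congr (_ * _).
rewrite powRN powR_mulrn ?ltW// -[_ *: _]/(_ * _) -[X in c * X]/(_ * _).
by rewrite mulr1 mulrN mulNr.
Qed.

(** * The reflection of x to c / x *)

Definition reflect_poly {R : nzRingType} (n : nat) (c : R) (P : {poly R}) :=
  \poly_(i < n.+1) (P`_(n - i) * c ^+ (n - i)).

Lemma horner_reflect_poly {R : fieldType} (n : nat) (c : R) (P : {poly R})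
    (x : R) :
  (size P <= n.+1)%N -> x != 0 ->
  (reflect_poly n c P).[x] = x ^+ n * P.[c / x].
Proof.
move=> sP x0; rewrite horner_poly (horner_coef_wide _ sP) big_distrr /=.
rewrite (reindex_inj rev_ord_inj); apply: eq_bigr => i _ /=.
have le_in : (i <= n)%N by rewrite -ltnS.
rewrite subSS subKn// expr_div_n.
have -> : x ^+ n = x ^+ (n - i) * x ^+ i by rewrite -exprD subnK.
rewrite [RHS]mulrC -!mulrA; congr (_ * (_ * _)).
by rewrite [x ^+ (n - i) * _]mulrC mulKf// expf_neq0.
Qed.

(** The exponent p = n / 2 is chosen so that x^n = x^p x^p and c^p is the n-th power of the root of
    c. *)
Lemma powR_half_reflect {R : realType} (n : nat) (c x : R) :
  0 < c -> 0 < x ->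
  x ^+ n * (c / x) `^ (n%:R / 2) = Num.sqrt c ^+ n * x `^ (n%:R / 2).
Proof.
move=> c0 x0; set p := n%:R / 2.
rewrite powRM ?invr_ge0 ?ltW// -(@powR_inv1 _ x) ?ltW// -powRrM mulN1r powRN.
have -> : c `^ p = Num.sqrt c ^+ n.
  rewrite -{1}[c]sqr_sqrtr ?ltW// -powR_mulrn ?sqrtr_ge0// -powRrM /p.
  by rewrite mulrC divfK ?pnatr_eq0// powR_mulrn// sqrtr_ge0.
have -> : x ^+ n = x `^ p * x `^ p.
  rewrite -powRD; last by rewrite (gt_eqF x0) implybT.
  by rewrite /p -splitr powR_mulrn ?ltW.
by field; rewrite gt_eqF ?powR_gt0.
Qed.

(** * Interpolation errors of a power function *)

Section PowerInterpolation.
Context {R : realType} (p : R).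

Definition power_error (P : {poly R}) (i : nat) (x : R) : R :=
  powR_family p i x - (derivn i P).[x].

Lemma der_family_power_error (P : {poly R}) : der_family (power_error P).
Proof.
by apply: der_familyB; [exact: der_family_powR|exact: der_family_horner].
Qed.

Lemma power_error0 (P : {poly R}) (x : R) :
  power_error P 0 x = x `^ p - P.[x].
Proof. by rewrite /power_error powR_family0. Qed.

(** [is_hermite] names the highest order matched, while the lemmas above count conditions; hence
    [k.+1] and [l.+1]. *)
Lemma is_hermite_powerP (a b : R) (k l : nat) (P : {poly R}) :
  0 < a -> 0 < b ->
  is_hermite (fun x => x `^ p) a k b l P <->
  [/\ (size P <= k.+1 + l.+1)%N,
      forall j, (j < k.+1)%N -> power_error P j a = 0 &
      forall j, (j < l.+1)%N -> power_error P j b = 0].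
Proof.
move=> a0 b0; have dE j x : 0 < x ->
    derive1n j (fun x => x `^ p) x = powR_family p j x.
  move=> x0; apply: derive1n_family x0; first exact: der_family_powR.
  by move=> y _; rewrite powR_family0.
rewrite addSn addnS; split=> -[sP Pa Pb]; split=> // j jk.
- by rewrite /power_error Pa// dE// subrr.
- by rewrite /power_error Pb// dE// subrr.
- by apply/esym/eqP; rewrite dE// -subr_eq0; apply/eqP; exact: Pa.
- by apply/esym/eqP; rewrite dE// -subr_eq0; apply/eqP; exact: Pb.
Qed.

(** Existence of an interpolant ensures that [xget] does not return its default. *)
Lemma hermite_powerP (a b : R) (k l : nat) : 0 < a -> 0 < b -> a != b ->
  is_hermite (fun x => x `^ p) a k b l (hermite (fun x => x `^ p) a k b l).
Proof.
move=> a0 b0 ab; apply: (@xgetPex _ 0).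
have [P [sP Pa Pb]] := @hermite_interpolation _ a b k.+1 l.+1
  (fun j => powR_family p j a) (fun j => powR_family p j b) ab.
exists P; apply/is_hermite_powerP => //; split=> // j jk.
- by rewrite /power_error Pa ?subrr.
- by rewrite /power_error Pb ?subrr.
Qed.

(** With s the root of c, the new error at x is s^-n x^n times the error of P at c / x. Inversion
    and a smooth factor both preserve the order of vanishing. *)
Lemma vanish_power_error_reflect (n k : nat) (c a : R) (P : {poly R}) :
  p = n%:R / 2 -> 0 < c -> 0 < a -> (size P <= n.+1)%N ->
  (forall j, (j < k)%N -> power_error P j a = 0) ->
  forall j, (j < k)%N ->
    power_error (Num.sqrt c ^- n *: reflect_poly n c P) j (c / a) = 0.
Proof.
move=> pE c0 a0 sP Pa.
have s0 : 0 < Num.sqrt c by rewrite sqrtr_gt0.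
have ca0 : 0 < c / a by exact: divr_gt0.
apply/(vanish_family k ca0 (der_family_power_error _)).
have := iffRL (vanish_family k a0 (der_family_power_error P)) Pa.
move=> /(vanish_inv c0 a0).
move=> /(vanish_mul (der_family_horner (Num.sqrt c ^- n *: 'X^n))).
apply: eq_vanish => // x x0.
rewrite !power_error0 derivn0 !hornerZ hornerXn horner_reflect_poly ?gt_eqF//.
rewrite -mulrA mulrBr mulrBr; congr (_ - _).
by rewrite pE powR_half_reflect// mulKf// expf_neq0 ?gt_eqF.
Qed.

End PowerInterpolation.

(* x^p minus Q + (x - a)^k (x - b)^l (L + c x^m) has k + l + m + 1 zeros, so its
   derivative of order k + l + m has one; only c survives in that derivative of
   the polynomial. *)
Lemma power_remainder {R : realType} (p a b : R) (k l m : nat)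
    (Q L : {poly R}) (c : R) (s : seq R) :
  0 < a -> a < b -> (size Q <= k + l)%N ->
  (forall j, (j < k)%N -> power_error p Q j a = 0) ->
  (forall j, (j < l)%N -> power_error p Q j b = 0) ->
  (size L <= m)%N -> sorted <%R s -> size s = m.+1 ->
  {in s, forall z, a < z < b /\
    z `^ p - Q.[z] = (z - a) ^+ k * (z - b) ^+ l * (L.[z] + c * z ^+ m)} ->
  exists2 xi, a <= xi <= b & powR_family p (k + l + m) xi = c *+ (k + l + m)`!.
Proof.
move=> a0 ab sQ Qa Qb sL ss szs sz.
pose W := ('X - a%:P) ^+ k * ('X - b%:P) ^+ l.
have sW : size W = (k + l).+1 by rewrite size_mul_XsubCX.
pose Z := Q + W * L + c *: (W * 'X^m).
have WE x : W.[x] = (x - a) ^+ k * (x - b) ^+ l.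
  by rewrite hornerM !horner_exp !hornerXsubC.
have ZQ : Z = Q + (L + c *: 'X^m) * W.
  by rewrite /Z mulrDl -scalerAl addrA ![W * _]mulrC.
have sWL : (size (W * L)%R <= k + l + m)%N.
  by rewrite (leq_trans (size_polyMleq _ _))// sW addSn /= leq_add2l.
have sWX : size (W * 'X^m)%R = (k + l + m).+1.
  by rewrite size_mulXn ?sW ?addnS 1?addnC// -size_poly_eq0 sW.
have [|||||xi xiab] := @rolle_multiplicity R a b (k + l + m)%N
  (power_error p Z) k l s a0 ab (der_family_power_error p Z).
- by rewrite szs addnS.
- by [].
- move=> j jk; rewrite /power_error ZQ /W [X in _ * X]mulrC mulrA derivnD.
  rewrite hornerD horner_derivn_mul_XsubCX_lt// addr0; exact: Qa.
- move=> j jl; rewrite /power_error ZQ /W mulrA derivnD.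
  rewrite hornerD horner_derivn_mul_XsubCX_lt// addr0; exact: Qb.
- move=> z /sz[zab zE]; split=> //; rewrite power_error0 ZQ hornerD hornerM WE.
  by rewrite hornerD hornerZ hornerXn mulrC opprD addrA zE mulrC subrr.
rewrite /power_error horner_derivn_top; last first.
  rewrite /Z (leq_trans (size_polyD _ _))// geq_max; apply/andP; split.
    rewrite (leq_trans (size_polyD _ _))// geq_max (leqW sWL) andbT.
    by rewrite (leq_trans sQ)// -addnS leq_addr.
  by rewrite (leq_trans (size_scale_leq _ _))// sWX.
have -> : Z`_(k + l + m) = c.
  rewrite /Z !coefD coefZ [Q`_ _]nth_default ?(leq_trans sQ) ?leq_addr//.
  rewrite [(W * L)`_ _]nth_default//.
  rewrite coefMXn ltnNge leq_addl /= addnK !add0r.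
  have : W \is monic by rewrite monicMl ?monic_exp ?monicXsubC.
  by rewrite monicE lead_coefE sW /= => /eqP ->; rewrite mulr1.
by move=> /eqP; rewrite subr_eq0 => /eqP; exists xi.
Qed.

(** * The geometric mean as the only solution *)

Section SquareRootCase.
Context {R : realType} (p a b : R) (m1 m2 : nat).
Hypotheses (m21 : (m2 < m1)%N) (even_m : ~~ odd (m1 + m2)).
Hypothesis (pE : p = (m1 + m2 + 1)%:R / 2%:R).
Hypotheses (a0 : 0 < a) (ab : a < b).

Let f (x : R) := x `^ p.
Let n := (m1 + m2 + 1)%N.
Let c := a * b.
Let s := Num.sqrt c.
Let P := hermite f a m1 b m2.
Let Q := hermite f a m2 b m1.

Let b0 : 0 < b. Proof. exact: lt_trans ab. Qed.
Let c0 : 0 < c. Proof. exact: mulr_gt0. Qed.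
Let s0 : 0 < s. Proof. by rewrite sqrtr_gt0. Qed.
Let s2 : s ^+ 2 = c. Proof. by rewrite sqr_sqrtr ?ltW. Qed.

Let PP : is_hermite f a m1 b m2 P.
Proof. by apply: hermite_powerP => //; rewrite lt_eqF. Qed.

Let QP : is_hermite f a m2 b m1 Q.
Proof. by apply: hermite_powerP => //; rewrite lt_eqF. Qed.

Lemma hermite_reflect (x : R) : 0 < x -> s ^+ n * Q.[x] = x ^+ n * P.[c / x].
Proof.
move=> x0.
have [sP Pa Pb] := iffLR (is_hermite_powerP p m1 m2 P a0 b0) PP.
have [sQ Qa Qb] := iffLR (is_hermite_powerP p m2 m1 Q a0 b0) QP.
have sPn : (size P <= n.+1)%N by rewrite (leq_trans sP)// /n; lia.
pose T := s ^- n *: reflect_poly n c P.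
(* Since c / a = b and c / b = a, the conditions of P at a and b change places and become those of
   Q. *)
have Tb : forall j, (j < m1.+1)%N -> power_error p T j b = 0.
  move=> j jm; have := vanish_power_error_reflect pE c0 a0 sPn Pa jm.
  by rewrite /c mulrAC divff ?gt_eqF// mul1r.
have Ta : forall j, (j < m2.+1)%N -> power_error p T j a = 0.
  move=> j jm; have := vanish_power_error_reflect pE c0 b0 sPn Pb jm.
  by rewrite /c mulfK ?gt_eqF.
have TQ : T - Q = 0.
  apply: (@hermite_zero R a b m2.+1 m1.+1) => //.
  - rewrite (leq_trans (size_polyD _ _))// geq_max size_polyN sQ andbT.
    rewrite (leq_trans (size_scale_leq _ _))// (leq_trans (size_poly _ _))//.
    rewrite /n; lia.
  - move=> j jm; have := Ta j jm; have := Qa j jm; rewrite /power_error.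
    rewrite derivnB hornerD hornerN => /subr0_eq <- /subr0_eq <-.
    by rewrite subrr.
  - move=> j jm; have := Tb j jm; have := Qb j jm; rewrite /power_error.
    rewrite derivnB hornerD hornerN => /subr0_eq <- /subr0_eq <-.
    by rewrite subrr.
rewrite -(subr0_eq TQ) hornerZ horner_reflect_poly ?gt_eqF//.
by rewrite mulVKf// expf_neq0 ?gt_eqF.
Qed.

Lemma powR_reflect (x : R) : 0 < x -> s ^+ n * f x = x ^+ n * f (c / x).
Proof. by move=> x0; rewrite /f pE powR_half_reflect. Qed.

(** Solutions beyond s need no separate estimate: reflection brings them to this side. *)
Lemma hermite_neq_left (x : R) : a < x -> x < s -> P.[x] != Q.[x].
Proof.
have lt_nN : (m1 + m2 + 1 < (m2.+1 + m1.+1) * 2)%N by lia.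
have le_kn : (2 * m2.+1 <= n)%N by rewrite /n; lia.
move=> ax xs; apply/eqP => PQx.
have x0 : 0 < x by exact: lt_trans ax.
pose y := c / x.
have y0 : 0 < y by exact: divr_gt0.
have cy : c / y = x by rewrite /y invf_div mulrCA divff ?mulr1// gt_eqF.
have sy : s < y by rewrite ltr_pdivlMr// -s2 expr2 ltr_pM2l.
have xb : x < b.
  apply: lt_trans xs _; rewrite -(ltr_pXn2r (n := 2)) ?nnegrE ?ltW// s2 /c.
  by rewrite expr2 ltr_pM2r.
have yb : y < b by rewrite ltr_pdivrMr// /c mulrC ltr_pM2l.
have xy : x < y by exact: lt_trans sy.
have ay : a < y by exact: lt_trans xy.
pose W z := (z - a) ^+ m2.+1 * (z - b) ^+ m1.+1.
(* The absolute value of W on (a, b), free of the sign (-1)^(m1 + 1). *)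
pose w z := (z - a) ^+ m2.+1 * (b - z) ^+ m1.+1.
have Ww z : W z = (-1) ^+ m1.+1 * w z.
  by rewrite /W /w -[z - b]opprB [(- (b - z)) ^+ _]exprNn mulrCA.
have wx : 0 < w x by rewrite mulr_gt0 ?exprn_gt0 ?subr_gt0.
have wy : 0 < w y by rewrite mulr_gt0 ?exprn_gt0 ?subr_gt0.
have W0 z : 0 < w z -> W z != 0.
  by move=> wz; rewrite Ww mulf_neq0 ?expf_neq0 ?oppr_eq0 ?oner_eq0 ?gt_eqF.
(* Reflection turns f - Q at y into f - P at x; the assumed equality P x = Q x then gives f - Q at
   x. *)
have gy : f y - Q.[y] = (s / x) ^+ n * (f x - Q.[x]).
  have sn0 : s ^+ n != 0 by rewrite expf_neq0 ?gt_eqF.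
  have yn : y ^+ n = s ^+ n * (s / x) ^+ n.
    by rewrite -exprMn mulrA -expr2 s2.
  apply: (mulfI sn0); rewrite mulrBr powR_reflect// hermite_reflect// cy.
  by rewrite PQx -mulrBr yn mulrA.
pose rx := (f x - Q.[x]) / W x.
pose ry := (f y - Q.[y]) / W y.
have rxE : f x - Q.[x] = W x * rx by rewrite mulrC divfK ?W0.
have ryE : f y - Q.[y] = W y * ry by rewrite mulrC divfK ?W0.
have [sQ Qa Qb] := iffLR (is_hermite_powerP p m2 m1 Q a0 b0) QP.
pose N := (m2.+1 + m1.+1)%N.
(* The coefficient of the derivative of order N of x^p. It is nonzero because n is odd, so p is no
   integer; multiplying by it avoids a case split on its sign. *)
pose sg : R := \prod_(i < N) (p - i%:R).
have sg0 : sg != 0.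
  apply/prodf_neq0 => i _; rewrite subr_eq0 pE; apply/eqP => pi.
  have : ((m1 + m2 + 1)%:R : R) = (2 * i)%:R.
    by rewrite natrM -pi mulrC divfK// pnatr_eq0.
  move=> /eqP; rewrite eqr_nat => /eqP/(congr1 odd).
  by rewrite oddD (negbTE even_m) mul2n odd_double.
have sgsq : 0 < sg ^+ 2 by rewrite exprn_even_gt0.
have pN : p - N%:R < 0.
  by rewrite subr_lt0 pE ltr_pdivrMr// -natrM ltr_nat.
(* The quotient of f - Q by W has the sign of sg, and the next derivative of f
   has the sign of -sg: |rx| > |ry| although ry is rx times a factor >= 1. *)
have rpos z r : a < z < b -> f z - Q.[z] = W z * r -> 0 < sg * r.
  move=> zab zE.
  have [||||xi /andP[axi _]] := @power_remainder R p a b m2.+1 m1.+1 0 Q 0 r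
      [:: z] a0 ab sQ Qa Qb.
  - by rewrite size_poly0.
  - by [].
  - by [].
  - move=> t; rewrite inE => /eqP ->; split=> //.
    by rewrite horner0 add0r expr0 mulr1.
  rewrite addn0 -/N /powR_family -/sg => e.
  have : 0 < (sg * r) *+ N`!.
    rewrite -mulrnAr -e mulrA -expr2 mulr_gt0// powR_gt0//.
    exact: lt_le_trans axi.
  by rewrite pmulrn_lgt0 ?fact_gt0.
have rxp := rpos x rx; have ryp := rpos y ry.
(* The slope of the line through (x, rx) and (y, ry). The remainder lemma with m = 1 ties it to the
   derivative of order N + 1, whose extra factor p - N is negative. *)
pose t := (ry - rx) / (y - x).
have tneg : sg * t < 0.
  have [||||xi /andP[axi _]] := @power_remainder R p a b m2.+1 m1.+1 1 Q
      (rx - t * x)%:P t [:: x; y] a0 ab sQ Qa Qb.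
  - exact: size_polyC_leq1.
  - by rewrite /= xy.
  - by [].
  - move=> z; rewrite !inE hornerC expr1 => /orP[] /eqP ->.
      by rewrite ax xb subrK.
    rewrite ay yb ryE; split=> //; congr (_ * _).
    by rewrite /t; field; rewrite subr_eq0 gt_eqF.
  rewrite /powR_family addn1 -/N big_ord_recr /= -/sg => e.
  have : (sg * t) *+ N.+1`! < 0.
    rewrite -mulrnAr -e mulrA mulrA -expr2 -mulrA pmulr_rlt0//.
    rewrite nmulr_rlt0// powR_gt0//; exact: lt_le_trans axi.
  by rewrite pmulrn_llt0 ?fact_gt0.
(* Under reflection (z - a)(b - z) gains the factor (s / x)^2, hence (s / x)^(2 (m2 + 1)) in w,
   which is at most (s / x)^n as s / x >= 1; the remaining factor b - z decreases. *)
have key : w y <= (s / x) ^+ n * w x.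
  have u1 : 1 <= s / x by rewrite ler_pdivlMr// mul1r ltW.
  have wE z : w z = ((z - a) * (b - z)) ^+ m2.+1 * (b - z) ^+ (m1 - m2).
    rewrite /w exprMn -mulrA -exprD; congr (_ * _ ^+ _).
    by rewrite addSn subnKC// ltnW.
  have yy : (y - a) * (b - y) = (s / x) ^+ 2 * ((x - a) * (b - x)).
    by rewrite expr_div_n s2 /y /c; field; rewrite gt_eqF.
  have v0 : 0 <= (x - a) * (b - x) by rewrite mulr_ge0// subr_ge0 ltW.
  have by0 : 0 <= b - y by rewrite subr_ge0 ltW.
  have bx0 : 0 <= b - x by rewrite subr_ge0 ltW.
  rewrite !wE yy exprMn -exprM -!mulrA.
  apply: ler_pM; first by rewrite exprn_ge0// divr_ge0// ltW.
  - by rewrite mulr_ge0// exprn_ge0.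
  - exact: ler_weXn2l.
  rewrite ler_wpM2l ?exprn_ge0// lerXn2r ?nnegrE//.
  by rewrite lerD2l lerN2 ltW.
have ryx : sg * ry < sg * rx.
  have : sg * t * (y - x) < 0 by rewrite pmulr_llt0 ?subr_gt0.
  by rewrite -mulrA divfK ?subr_eq0 ?gt_eqF// mulrBr subr_lt0.
have : ry = (s / x) ^+ n * w x / w y * rx.
  rewrite /ry gy rxE !Ww; field.
  by rewrite expf_neq0 ?oppr_eq0 ?oner_eq0 ?gt_eqF.
move=> ryE'; move: ryx; apply/negP; rewrite -leNgt.
have -> : sg * ry = (s / x) ^+ n * w x / w y * (sg * rx).
  by rewrite ryE' mulrCA.
apply: ler_peMl; first by rewrite ltW// rxp// ax xb.
by rewrite ler_pdivlMr// mul1r.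
Qed.

Lemma hermite_mean_lt_sqrt : hermite_mean_lt f m1 m2 a b = s.
Proof.
have sn0 : s ^+ n != 0 by rewrite expf_neq0 ?gt_eqF.
(* As m1 - m2 is even, the sign is 1 and f cancels. *)
have eqE x : hermite_mean_eq f m1 m2 a b x <-> P.[x] = Q.[x].
  rewrite /hermite_mean_eq -/P -/Q -signr_odd oddB ?(ltnW m21)// -oddD.
  rewrite (negbTE even_m) expr0 mul1r.
  by split=> [/addrI/oppr_inj//|->].
apply: xget_unique => /=.
  split; last first.
    apply/eqE; apply: (mulfI sn0); rewrite hermite_reflect//.
    by rewrite -s2 expr2 mulfK ?gt_eqF.
  rewrite -[a < s](ltr_pXn2r (n := 2)) ?nnegrE ?ltW//.
  rewrite -[s < b](ltr_pXn2r (n := 2)) ?nnegrE ?ltW//.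
  by rewrite s2 /c !expr2 ltr_pM2l// ltr_pM2r// ab.
move=> x [/andP[ax xb] /eqE PQx].
have x0 : 0 < x by exact: lt_trans ax.
have [xs|sx|//] := ltgtP x s.
  by have := hermite_neq_left ax xs; rewrite PQx eqxx.
have y0 : 0 < c / x by exact: divr_gt0.
have ay : a < c / x by rewrite ltr_pdivlMr// ltr_pM2l.
have ys : c / x < s by rewrite ltr_pdivrMr// -s2 expr2 ltr_pM2l.
have cy : c / (c / x) = x by rewrite invf_div mulrCA divff ?mulr1// gt_eqF.
have /eqP[] := hermite_neq_left ay ys.
(* For x > s the reflected point c / x < s is a solution too: multiplied by s^n x^n, its two sides
   become c^n Q x and c^n P x. *)
have xn0 : x ^+ n != 0 by rewrite expf_neq0 ?gt_eqF.
apply: (mulfI xn0); apply: (mulfI sn0).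
rewrite -hermite_reflect// [RHS]mulrCA (hermite_reflect y0) cy PQx.
rewrite !mulrA -!exprMn [x * _]mulrC divfK ?gt_eqF//.
by rewrite -s2 expr2.
Qed.

End SquareRootCase.

Theorem theorem8 (R : realType) (m1 m2 : nat) (p : R)
    (hm : (m2 < m1)%N) (heven : ~~ odd (m1 + m2))
    (hp : p = (m1 + m2 + 1)%:R / 2%:R)
    (a b : R) (ha : 0 < a) (hb : 0 < b) :
  power_hermite_mean p m1 m2 a b = Num.sqrt (a * b).
Proof.
rewrite /power_hermite_mean /hermite_mean.
case: ltgtP => [ab|ba|->]; first exact: hermite_mean_lt_sqrt.
  by rewrite hermite_mean_lt_sqrt// mulrC.
by rewrite -expr2 sqrtr_sqr gtr0_norm.
Qed.
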